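(* Let $n\ge1$ and $s\in(0,1/2)$. Let $K:\mathbb{R}^n\times\mathbb{R}^n\to[0,+\infty]$ be a non-negative measurable function with $K(x,y)=K(y,x)$ for a.a. $x,y\in\mathbb{R}^n$. Let $W:\mathbb{R}^n\times\mathbb{R}\to[0,+\infty)$ be measurable, locally of class $C^1$ in the second variable, and such that: $W(x,\pm1)=0$ for a.a. $x\in\mathbb{R}^n$; for any $\theta\in[0,1)$, $\inf_{x\in\mathbb{R}^n,\,|r|\le\theta}W(x,r)\ge\gamma(\theta)$, where $\gamma:[0,1)\to(0,+\infty)$ is non-increasing; and $W(x,r)\le\kappa^{-1}$, $|W_r(x,r)|\le\kappa^{-1}$ for a.a. $x\in\mathbb{R}^n$ and any $r\in\mathbb{R}$, for some $\kappa\in(0,1)$. Then the family of functionals $\mathscr{E}_\varepsilon$ $\Gamma$-converges to $\mathscr{G}$ on $\mathcal{X}$ as $\varepsilon\to0^+$. That is: (i) for any $u_\varepsilon$ converging to $u$ in $\mathcal{X}$, $$\mathscr{G}(u;\Omega)\le\liminf_{\varepsilon\to0^+}\mathscr{E}_\varepsilon(u_\varepsilon;\Omega)\quad\text{for any open set }\Omega\subseteq\mathbb{R}^n;$$ (ii) for any $u\in\mathcal{X}$ there exists $u_\varepsilon$ converging to $u$ in $\mathcal{X}$ such that $$\mathscr{G}(u;\Omega)\ge\limsup_{\varepsilon\to0^+}\mathscr{E}_\varepsilon(u_\varepsilon;\Omega)\quad\text{for any open set }\Omega\subseteq\mathbb{R}^n.$$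
   Context: $\mathcal{X}=\{u\in L^\infty(\mathbb{R}^n):\|u\|_{L^\infty(\mathbb{R}^n)}\le1\}$, endowed with the $L^1_{\rm loc}(\mathbb{R}^n)$ topology. For $\Omega\subseteq\mathbb{R}^n$ let $\mathscr{C}_\Omega=(\mathbb{R}^n\times\mathbb{R}^n)\setminus((\mathbb{R}^n\setminus\Omega)\times(\mathbb{R}^n\setminus\Omega))$ and $\mathscr{K}(u;\Omega)=\frac12\iint_{\mathscr{C}_\Omega}|u(x)-u(y)|^2K(x,y)\,dx\,dy$. For $\varepsilon>0$, $\mathscr{E}_\varepsilon(u;\Omega)=\mathscr{K}(u;\Omega)+\frac{1}{\varepsilon^{2s}}\int_\Omega W(x,u(x))\,dx$. The functional $\mathscr{G}(\cdot;\Omega):\mathcal{X}\to[0,+\infty]$ is defined by $\mathscr{G}(u;\Omega)=\mathscr{K}(u;\Omega)$ if $u|_\Omega=\chi_E-\chi_{\mathbb{R}^n\setminus E}$ for some measurable $E\subseteq\Omega$, and $\mathscr{G}(u;\Omega)=+\infty$ otherwise. *)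

(* Defs.v *)
From HB Require Import structures.
From mathcomp Require Import all_boot all_order all_algebra.
From mathcomp Require Import all_classical all_reals all_analysis.
From mathcomp Require Import measurable_realfun.
Import Order.TTheory GRing.Theory Num.Theory.
Import numFieldNormedType.Exports.

Set Implicit Arguments.
Unset Strict Implicit.
Unset Printing Implicit Defensive.

Local Open Scope classical_set_scope.
Local Open Scope ring_scope.
Local Open Scope ereal_scope.

Section lebesgue_rV.
Context {R : realType} {n : nat}.

(* [None] stands for the empty box, so that the covers below may be finite.   *)
Definition box (B : option ('rV[R]_n * 'rV[R]_n)) : set 'rV[R]_n :=
  if B is Some (a, b)
  then [set x | forall i, (a ord0 i < x ord0 i <= b ord0 i)%R] else set0.

Definition volume (B : option ('rV[R]_n * 'rV[R]_n)) : R :=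
  (if B is Some (a, b)
   then \prod_(i < n) Num.max 0 (b ord0 i - a ord0 i) else 0)%R.

Definition lebesgue_outer (A : set 'rV[R]_n) : \bar R :=
  ereal_inf [set \sum_(k <oo) (volume (B k))%:E |
    B in [set B : nat -> option ('rV[R]_n * 'rV[R]_n) |
            A `<=` \bigcup_k box (B k)]].

Lemma volume_ge0 B : (0 <= volume B)%R.
Proof.
case: B => [[a b]|] //=; apply: prodr_ge0 => i _.
by rewrite le_max lexx.
Qed.

Let volumeE_ge0 B : 0 <= (volume B)%:E.
Proof. by rewrite lee_fin volume_ge0. Qed.

Lemma lebesgue_outer_ge0 A : 0 <= lebesgue_outer A.
Proof.
by apply: le_ereal_inf_tmp => x [B _ <-{x}]; exact: nneseries_ge0.
Qed.

Lemma lebesgue_outer0 : lebesgue_outer set0 = 0.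
Proof.
apply/eqP; rewrite eq_le lebesgue_outer_ge0 andbT.
apply: ereal_inf_lbound; exists (fun=> None) => //=.
by rewrite eseries0.
Qed.

Lemma le_lebesgue_outer : {homo lebesgue_outer : A B / A `<=` B >-> A <= B}.
Proof.
move=> A B AB; apply/ereal_inf_le_tmp => x [C BC <-{x}].
by exists C => //; exact: subset_trans BC.
Qed.

Lemma lebesgue_outer_sigma_subadditive : sigma_subadditive lebesgue_outer.
Proof.
move=> A; have [[i ioo]|] := pselect (exists i, lebesgue_outer (A i) = +oo).
  rewrite (eseries_pinfty _ _ ioo) ?leey// => k _.
  by rewrite -ltNye (lt_le_trans _ (lebesgue_outer_ge0 _)).
rewrite -forallNE => Aoo.
suff add2e (e : {posnum R}) :
    lebesgue_outer (\bigcup_k A k) <=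
    \sum_(i <oo) lebesgue_outer (A i) + e%:num%:E.
  by apply/lee_addgt0Pr => _/posnumP[].
rewrite (le_trans _ (epsilon_trick _ _ _))//; last first.
  by move=> k; exact: lebesgue_outer_ge0.
pose P k (B : nat -> option ('rV[R]_n * 'rV[R]_n)) :=
  A k `<=` \bigcup_j box (B j) /\
  \sum_(j <oo) (volume (B j))%:E <=
    lebesgue_outer (A k) + (e%:num / (2 ^ k.+1)%:R)%:E.
have [G PG] : {G : nat -> nat -> option ('rV[R]_n * 'rV[R]_n) &
    forall k, P k (G k)}.
  apply: (@choice _ _ P) => k; rewrite /P /lebesgue_outer.
  set S := (X in ereal_inf X); move infS : (ereal_inf S) => iS.
  case: iS infS => [r Sr|Soo|Soo].
  - have en1 : (0 < e%:num / (2 ^ k.+1)%:R)%R by [].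
    have /(lb_ereal_inf_adherent en1) : ereal_inf S \is a fin_num by rewrite Sr.
    move=> [x [B AnB muBx] xS].
    by exists B; split => //; rewrite muBx -Sr; exact/ltW.
  - by have := Aoo k; rewrite /lebesgue_outer Soo.
  - suff : lbound S 0 by move/le_ereal_inf_tmp; rewrite Soo.
    by move=> /= _ [B AnB <-]; exact: nneseries_ge0.
pose v (p : nat * nat) := (volume (G p.1 p.2))%:E.
have v_ge0 p : 0 <= v p by exact: volumeE_ge0.
apply: (@le_trans _ _ (\esum_(p in setT) v p)).
  apply: ereal_inf_lbound => /=.
  have /card_esym/ppcard_eqP[f] := card_nat2.
  exists (fun k => G (f k).1 (f k).2).
    move=> t [i _ /(PG i).1[j _ Bijt]].
    by exists (f^-1%FUN (i, j)) => //=; rewrite invK ?inE.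
  rewrite -(esum_pred_image v _ xpredT) ?[fun=> _]set_true//.
  by rewrite image_eq.
rewrite (_ : esum _ _ = \sum_(i <oo) \sum_(j <oo) v (i, j)); last first.
  pose J : nat -> set (nat * nat) := fun i => [set (i, j) | j in setT].
  rewrite (_ : setT = \bigcup_k J k); last first.
    by rewrite predeqE => -[a b]; split => // _; exists a => //; exists b.
  rewrite esum_bigcupT /=; last 2 first.
    - apply/trivIsetP => i j _ _ ij.
      rewrite predeqE => -[k m] /=; split => //= -[] [_] _ [<-{k} _].
      by move=> [m' _] [] /esym/eqP; rewrite (negbTE ij).
    - by move=> p; exact: v_ge0.
  rewrite -(image_id [set: nat]) -fun_true esum_pred_image//; last first.
    by move=> k _; exact: esum_ge0.
  apply: eq_eseriesr => /= j _.
  rewrite -(esum_pred_image v (pair j) predT)//=; last first.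
    by move=> ? ? _ _; exact: (@can_inj _ _ _ snd).
  by congr esum; rewrite predeqE => -[a b]; split; move=> [i _ <-]; exists i.
apply: lee_lim.
- apply: is_cvg_nneseries => k *.
  by apply: nneseries_ge0 => m *; exact: (v_ge0 (k, m)).
- apply: is_cvg_nneseries => k *.
  by apply: adde_ge0 => //; exact: lebesgue_outer_ge0.
- by near=> k; apply: lee_sum => i _; exact: (PG i).2.
Unshelve. all: by end_near. Qed.

HB.instance Definition _ := isOuterMeasure.Build R 'rV[R]_n lebesgue_outer
  lebesgue_outer0 lebesgue_outer_ge0 le_lebesgue_outer
  lebesgue_outer_sigma_subadditive.

(* Measurable sets of R^n are the Lebesgue measurable ones (in Caratheodory's *)
(* sense), not only the Borel ones.                                           *)
HB.instance Definition _ := @isMeasurable.Build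
  (caratheodory_display lebesgue_outer) 'rV[R]_n (caratheodory_measurable lebesgue_outer)
    (caratheodory_measurable_set0 lebesgue_outer)
    (@caratheodory_measurable_setC _ _ lebesgue_outer)
    (@caratheodory_measurable_bigcup _ _ lebesgue_outer).

Definition lebesgue_rV : set 'rV[R]_n -> \bar R := lebesgue_outer.

HB.instance Definition _ := isMeasure.Build _ _ _ lebesgue_rV
  (@caratheodory_measure0 _ _ lebesgue_outer)
  (@caratheodory_measure_ge0 _ _ lebesgue_outer)
  (@caratheodory_measure_sigma_additive _ _ lebesgue_outer).

End lebesgue_rV.

Section functionals.
Context {R : realType} {n : nat}.
Implicit Types (u : 'rV[R]_n -> R) (Omega : set 'rV[R]_n).
Local Notation mu := (@lebesgue_rV R n).

Definition calX : set ('rV[R]_n -> R) :=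
  [set u | measurable_fun setT u /\ 'N[mu]_+oo[EFin \o u] <= 1].

Definition L1loc_cvg {I : Type} (F : set_system I) (v : I -> 'rV[R]_n -> R) u :=
  forall C : set 'rV[R]_n, compact C ->
    \int[mu]_(x in C) (`|v e x - u x|%R)%:E @[e --> F] --> 0.

(* R^n x R^n is identified with R^(n+n); a point z stands for the pair        *)
(* (lsubmx z, rsubmx z).                                                      *)
Definition crossing Omega : set 'rV[R]_(n + n) :=
  ~` [set z | (~` Omega `*` ~` Omega) (lsubmx z, rsubmx z)].

Definition calK (K : 'rV[R]_n -> 'rV[R]_n -> \bar R) u Omega : \bar R :=
  (2^-1)%R%:E * \int[@lebesgue_rV R (n + n)]_(z in crossing Omega)
    ((`|u (lsubmx z) - u (rsubmx z)| ^+ 2)%R%:E * K (lsubmx z) (rsubmx z)).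

Definition calE (s : R) (K : 'rV[R]_n -> 'rV[R]_n -> \bar R)
    (W : 'rV[R]_n -> R -> R) (eps : R) u Omega : \bar R :=
  calK K u Omega +
  (1 / eps `^ (2 * s))%R%:E * \int[mu]_(x in Omega) (W x (u x))%:E.

(* Elements of [calX] are classes modulo null sets, hence the almost          *)
(* everywhere equality on [Omega].                                            *)
Definition calG (K : 'rV[R]_n -> 'rV[R]_n -> \bar R) u Omega : \bar R :=
  if `[< exists E : set 'rV[R]_n, [/\ measurable E, E `<=` Omega &
         {ae mu, forall x, Omega x -> u x = (\1_E x - \1_(~` E) x)%R}] >]
  then calK K u Omega else +oo.

End functionals.

(* Main.v *)
(* For (ii) the constant family u_eps = u works: where u = 1 or u = -1 almost
   everywhere the potential term vanishes.  For (i), given c above the liminf,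
   pick eps_k -> 0 with energy below c, with eps_k^(2s) summable, and such that
   |u_(eps_k) - u| has summable integrals on larger and larger cubes, so that
   u_(eps_k) -> u almost everywhere.  Since W >= gamma(theta) on |r| <= theta,
   the sets where |u_(eps_k)| <= theta have summable measures in Omega, and
   Borel-Cantelli gives |u| >= theta a.e. there for each theta < 1, hence
   |u| = 1.  Fatou's lemma bounds the kinetic term.  To apply it one needs both
   projections of R^(n+n) onto R^n to be measurable for the Lebesgue (not only
   the Borel) sets and to pull null sets back to null sets. *)
Require Import Defs.
From HB Require Import structures.
From mathcomp Require Import all_boot all_order all_algebra.
From mathcomp Require Import all_classical all_reals all_analysis.
From mathcomp Require Import measurable_realfun.
From mathcomp Require Import lra.
Import Order.TTheory GRing.Theory Num.Theory.
Import numFieldNormedType.Exports.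

Set Implicit Arguments.
Unset Strict Implicit.
Unset Printing Implicit Defensive.

Local Open Scope classical_set_scope.
Local Open Scope ring_scope.
Local Open Scope ereal_scope.

(** * Open sets of R^n are Lebesgue measurable *)

Section lebesgue_measurable.
Context {R : realType} {n : nat}.
Local Notation mu := (@lebesgue_rV R n).
Implicit Types (A N : set 'rV[R]_n) (a b x : 'rV[R]_n).
Local Notation obox := (option ('rV[R]_n * 'rV[R]_n)).

Let volumeE_ge0 (B : obox) : 0 <= (volume B)%:E.
Proof. by rewrite lee_fin volume_ge0. Qed.

Lemma max0_splitr (p q c : R) :
  (Num.max 0 (Num.min q c - p) + Num.max 0 (q - Num.max p c) =
   Num.max 0 (q - p))%R.
Proof.
rewrite /Num.max /Num.min.
by repeat case: ifPn; rewrite -?leNgt ?subr_lt0 ?subr_gt0; lra.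
Qed.

(** Cutting a half-open box along a hyperplane x_i = c leaves two half-open boxes; an empty piece
    gets volume 0 because side lengths are truncated at 0. *)
Definition box_below (i : 'I_n) (c : R) (B : obox) : obox :=
  if B is Some (a, b) then
    Some (a, \row_j if j == i then Num.min (b ord0 j) c else b ord0 j)%R
  else None.

Definition box_above (i : 'I_n) (c : R) (B : obox) : obox :=
  if B is Some (a, b) then
    Some (\row_j if j == i then Num.max (a ord0 j) c else a ord0 j, b)%R
  else None.

Lemma volume_split i c (B : obox) :
  (volume (box_below i c B) + volume (box_above i c B) = volume B)%R.
Proof.
case: B => [[a b]|]; last by rewrite /= addr0.
rewrite /= (bigD1 i)//= [X in (_ + X)%R](bigD1 i)//= [RHS](bigD1 i)//=.
rewrite !mxE eqxx -[RHS](congr1 (fun t => t * _)%R (max0_splitr _ _ c)) mulrDl.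
by congr (_ * _ + _ * _)%R; apply: eq_bigr => j /negbTE ji; rewrite mxE ji.
Qed.

Lemma box_below_sub i c (B : obox) :
  box B `&` [set x | (x ord0 i <= c)%R] `<=` box (box_below i c B).
Proof.
case: B => [[a b]|]; last by move=> x [].
move=> x [/= xab xc] j; rewrite mxE; have /andP[-> xb] /= := xab j.
by case: eqP => [->|//]; rewrite le_min xc andbT; have /andP[] := xab i.
Qed.

Lemma box_above_sub i c (B : obox) :
  box B `&` ~` [set x | (x ord0 i <= c)%R] `<=` box (box_above i c B).
Proof.
case: B => [[a b]|]; last by move=> x [].
move=> x [/= xab /negP]; rewrite -ltNge => xc j; rewrite mxE.
have /andP[xa ->] /= := xab j; rewrite andbT.
by case: eqP => [->|//]; rewrite gt_max xc andbT; have /andP[] := xab i.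
Qed.

Lemma lebesgue_outer_cover A (B : nat -> obox) :
  A `<=` \bigcup_k box (B k) -> lebesgue_outer A <= \sum_(k <oo) (volume (B k))%:E.
Proof. by move=> AB; apply: ereal_inf_lbound; exists B. Qed.

(** Caratheodory's criterion: cutting every box of a cover of [X] along the hyperplane covers both
    parts of [X] at the same total volume. *)
Lemma halfspace_measurable (i : 'I_n) (c : R) :
  measurable [set x : 'rV[R]_n | (x ord0 i <= c)%R].
Proof.
apply: le_caratheodory_measurable => X /=.
apply: le_ereal_inf_tmp => _ [B XB <-].
have -> : \sum_(k <oo) (volume (B k))%:E =
  \sum_(k <oo) (volume (box_below i c (B k)))%:E +
  \sum_(k <oo) (volume (box_above i c (B k)))%:E.
  rewrite -nneseriesD//; apply: eq_eseriesr => k _.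
  by rewrite -EFinD volume_split.
apply: leeD; apply: lebesgue_outer_cover => x [Xx xc];
  have [k _ Bx] := XB x Xx; exists k => //.
- exact: box_below_sub.
- exact: box_above_sub.
Qed.

Lemma measurable_coord (i : 'I_n) :
  measurable_fun [set: 'rV[R]_n] (fun x => x ord0 i).
Proof.
apply: (measurability _ (RGenOInfty.measurableE R)) => _ [_ [c ->] <-].
rewrite setTI -[X in measurable X]setCK; apply: measurableC.
rewrite (_ : ~` _ = [set x : 'rV[R]_n | (x ord0 i <= c)%R]).
  exact: halfspace_measurable.
apply/seteqP; split => x /=; rewrite in_itv/= andbT leNgt; first by move/negP.
by move/negP.
Qed.

Lemma preimage_coordinatewise_measurable d (T : measurableType d)
    (p : T -> 'rV[R]_n) (P : 'I_n -> set R) :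
  (forall i, measurable_fun setT (fun z => p z ord0 i)) ->
  (forall i, measurable (P i)) ->
  measurable [set z | forall i, P i (p z ord0 i)].
Proof.
move=> mp mP.
rewrite (_ : [set _ | _] = \bigcap_i ((fun z => p z ord0 i) @^-1` P i)).
  apply: fin_bigcap_measurable => // i _; rewrite -[X in measurable X]setTI.
  exact: mp.
by apply/seteqP; split => x /= Px i => [_|]; exact: Px.
Qed.

Lemma preimage_box_measurable d (T : measurableType d) (p : T -> 'rV[R]_n)
    (B : obox) :
  (forall i, measurable_fun setT (fun z => p z ord0 i)) ->
  measurable (p @^-1` box B).
Proof.
move=> mp; case: B => [[a b]|]; last by rewrite preimage_set0; exact: measurable0.
apply: (@preimage_coordinatewise_measurable _ _ p
  (fun i => [set t | (a ord0 i < t <= b ord0 i)%R])) => // i.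
by rewrite (_ : [set _ | _] = `]a ord0 i, b ord0 i]%classic).
Qed.

Lemma box_measurable (B : obox) : measurable (box B).
Proof. exact: (@preimage_box_measurable _ _ id B measurable_coord). Qed.

(** Boxes with rational corners are countably many, so it is enough that each point of [A] lies in
    one that is contained in [A]. *)
Lemma open_measurable_rV A : open A -> measurable A.
Proof.
move=> oA.
pose qbox (q : 'rV[rat]_n * 'rV[rat]_n) :=
  box (Some (map_mx (@ratr R) q.1, map_mx (@ratr R) q.2)).
rewrite (_ : A = \bigcup_q (if `[< qbox q `<=` A >] then qbox q else set0)).
  apply: countable_bigcupT_measurable => // q.
  by case: ifP => _; [exact: box_measurable|exact: measurable0].
apply/seteqP; split => [x Ax|x [q _]]; last by case: asboolP => // qA /qA.
(* A neighbourhood of a matrix contains a product of neighbourhoods [P] of its entries, so the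
   corners can be chosen coordinate by coordinate. *)
have [P xP PA] : nbhs x A by exact: open_nbhs_nbhs.
have /choice[q xq] : forall i, exists q : rat * rat,
    (ratr q.1 < x ord0 i <= ratr q.2)%R /\
    [set` `]ratr q.1, ratr q.2] ] `<=` P ord0 i.
  move=> i; have /nbhs_ballP[e /= e0 xeP] := xP ord0 i.
  have [p] : exists p : rat, ratr p \in `](x ord0 i - e)%R, x ord0 i[.
    by apply: rat_in_itvoo; rewrite ltrBlDr ltrDl.
  have [r] : exists r : rat, ratr r \in `]x ord0 i, (x ord0 i + e)%R[.
    by apply: rat_in_itvoo; rewrite ltrDl.
  rewrite !in_itv/= => /andP[xr rx] /andP[xp px].
  exists (p, r); split; first by rewrite px ltW.
  move=> y /=; rewrite in_itv/= => /andP[py yr]; apply: xeP.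
  by rewrite /ball/= ltr_norml; lra.
exists (\row_i (q i).1, \row_i (q i).2)%R => //; rewrite asboolT.
  by move=> i; rewrite !mxE; have [] := xq i.
move=> y qy; apply: PA => i j; rewrite (ord1 i).
by have [_] := xq j; apply; have := qy j; rewrite /= in_itv/= !mxE.
Qed.

End lebesgue_measurable.

(** * Null sets, and hulls of measurable sets by boxes *)

Section lebesgue_null.
Context {R : realType} {n : nat}.
Local Notation mu := (@lebesgue_rV R n).
Implicit Types A : set 'rV[R]_n.
Local Notation obox := (option ('rV[R]_n * 'rV[R]_n)).

Lemma lebesgue_le0 A : mu A <= 0 -> mu A = 0.
Proof. by move=> A0; apply/eqP; rewrite eq_le A0 lebesgue_outer_ge0. Qed.

(** Completeness: in Caratheodory's criterion the part of [X] inside [A] costs 0, and the part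
    outside costs at most [X] by monotonicity. *)
Lemma null_measurable A : mu A = 0 -> measurable A.
Proof.
move=> A0; apply: le_caratheodory_measurable => X /=.
have -> : lebesgue_outer (X `&` A) = 0.
  by apply: lebesgue_le0; rewrite -A0; exact: le_lebesgue_outer.
by rewrite add0e; exact: le_lebesgue_outer.
Qed.

Lemma lebesgue_box_le (B : obox) : mu (box B) <= (volume B)%:E.
Proof.
pose C (k : nat) : obox := if k == 0%N then B else None.
have BC : box B `<=` \bigcup_k box (C k) by move=> x Bx; exists 0%N.
apply: (le_trans (lebesgue_outer_cover BC)).
rewrite nneseries_recl//=; last by move=> k _; rewrite lee_fin volume_ge0.
rewrite eseries0 ?adde0// => k k0 _.
by rewrite /C eqn0Ngt k0.
Qed.

(** Half-open, so as to be a [box]. The cube of index 0 is degenerate, whence the [k.+1] wherever a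
    positive volume is required. *)
Definition cube (k : nat) : obox :=
  Some (const_mx (- k%:R), const_mx k%:R)%R.

Lemma cube_cover : \bigcup_k box (cube k) = setT.
Proof.
apply/seteqP; split => // x _.
have [k xk] : exists k : nat, forall i, (`|x ord0 i| < k%:R)%R.
  have /choice[f xf] : forall i, exists k : nat, (`|x ord0 i| < k%:R)%R.
    move=> i; exists (Num.trunc `|x ord0 i|).+1.
    by rewrite truncnS_gt.
  exists (\max_i f i)%N => i; apply: lt_le_trans (xf i) _.
  by rewrite ler_nat (leq_bigmax i).
exists k => // i; rewrite !mxE.
by have := xk i; rewrite ltr_norml => /andP[-> /ltW].
Qed.

Lemma outer_cover_lt A (e : R) : (0 < e)%R -> mu A < +oo ->
  exists2 B : nat -> obox, A `<=` \bigcup_k box (B k) &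
    \sum_(k <oo) (volume (B k))%:E < mu A + e%:E.
Proof.
move=> e0 Aoo; have Afin : mu A \is a fin_num by rewrite ge0_fin_numE.
by have [_ [B AB <-]] := lb_ereal_inf_adherent e0 Afin; exists B.
Qed.

(** For each j take a cover of total volume below mu A + 1/(j+1); the intersection of the unions
    contains [A] and has the same measure. *)
Lemma box_hull A : measurable A -> mu A < +oo ->
  exists B : nat -> nat -> obox,
    A `<=` \bigcap_j \bigcup_k box (B j k) /\
    mu ((\bigcap_j \bigcup_k box (B j k)) `\` A) = 0.
Proof.
move=> mA Aoo.
have /choice[B AB] : forall j : nat, exists B : nat -> obox,
    A `<=` \bigcup_k box (B k) /\
    \sum_(k <oo) (volume (B k))%:E < mu A + (j.+1%:R^-1)%:E.
  move=> j; have [//|B ? ?] := @outer_cover_lt A (j.+1%:R^-1) _ Aoo.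
  by exists B.
exists B; set G := \bigcap_j _.
have AG : A `<=` G by move=> x Ax j _; exact: (AB j).1.
split => //.
have Gj j : mu G <= mu A + (j.+1%:R^-1)%:E.
  apply: le_trans (ltW (AB j).2); rewrite /lebesgue_rV; apply: lebesgue_outer_cover => x; exact.
have GA : mu G <= mu A.
  apply/lee_addgt0Pr => e e0.
  have [j je] : exists j : nat, (j.+1%:R^-1 < e)%R.
    exists (Num.trunc e^-1); rewrite invf_plt ?posrE// truncnS_gt//.
  by apply: le_trans (Gj j) _; rewrite leeD2l// lee_fin ltW.
apply: lebesgue_le0.
(* Caratheodory's criterion for [A], tested on [G], splits mu G into mu A and the measure of the
   difference; mu A is finite and cancels. *)
have := mA G; rewrite setIC setIidl// -setDE /lebesgue_rV => Gsplit.
by rewrite -(@leeD2lE _ (mu A)) ?ge0_fin_numE ?lebesgue_outer_ge0// adde0 -Gsplit.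
Qed.

Lemma volume_cube_gt0 k : (0 < volume (cube k.+1))%R.
Proof.
apply: prodr_gt0 => i _; rewrite !mxE lt_max; apply/orP; right.
by rewrite opprK -natrD ltr0n.
Qed.

End lebesgue_null.

(** * Pulling back null sets and measurable sets along a map *)

Section lift.
Context {R : realType} {n N : nat} (p : 'rV[R]_N -> 'rV[R]_n).
Local Notation mu := (@lebesgue_rV R).

(** A cover of [A] of total volume below e / c becomes a cover of the restricted preimage of total
    volume at most e. The set [D] is there because the preimage of a box under a projection is
    unbounded. *)
Lemma null_preimage_restr (D : set 'rV[R]_N) (c : R) : (0 < c)%R ->
  (forall B, exists B', p @^-1` box B `&` D `<=` box B' /\
                        (volume B' <= c * volume B)%R) ->
  forall A : set 'rV[R]_n, mu A = 0 -> mu (p @^-1` A `&` D) = 0.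
Proof.
move=> c0 /choice[f fP] A A0; apply: lebesgue_le0.
apply/lee_addgt0Pr => e e0; rewrite add0e.
have [||B AB] := @outer_cover_lt R n A (e / c); [exact: divr_gt0|by rewrite A0|].
rewrite A0 add0e => Be.
apply: (@le_trans _ _ (\sum_(k <oo) (volume (f (B k)))%:E)).
  rewrite /lebesgue_rV; apply: lebesgue_outer_cover => x [/AB[k _ Bx] Dx].
  by exists k => //; apply: (fP _).1.
apply: (@le_trans _ _ (\sum_(k <oo) (c%:E * (volume (B k))%:E))).
  apply: lee_nneseries => k _; first by rewrite lee_fin volume_ge0.
  by rewrite -EFinM lee_fin (fP _).2.
rewrite nneseriesZl; last by move=> k; rewrite lee_fin volume_ge0.
by rewrite muleC -lee_pdivlMr// -EFinM ltW.
Qed.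

(** Removes the restriction to a bounded [D], by countable subadditivity. *)
Lemma null_of_cubes (A : set 'rV[R]_N) :
  (forall k, mu (A `&` p @^-1` box (cube k.+1)) = 0) -> mu A = 0.
Proof.
move=> A0; apply: lebesgue_le0.
apply: le_trans (_ : mu (\bigcup_k (A `&` p @^-1` box (cube k.+1))) <= 0).
  apply: le_lebesgue_outer => x Ax.
  have : (\bigcup_k box (@cube R n k)) (p x) by rewrite cube_cover.
  case=> k _ pk; exists k => //; split => // i; have := pk i.
  rewrite !mxE => /andP[kp pk'].
  by rewrite (le_lt_trans _ kp) ?(le_trans pk')// ?lerN2 ler_nat.
apply: le_trans (lebesgue_outer_sigma_subadditive _) _.
by rewrite eseries0// => k _ _; exact: A0.
Qed.

(* A measurable set is, up to a null set, a countable combination of boxes. *)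
Hypothesis box_preimage : forall B, measurable (p @^-1` box B).
Hypothesis null_preimage : forall A, mu A = 0 -> mu (p @^-1` A) = 0.

(** Inside a cube, [A] has finite measure and is its box hull minus a null set. The hull pulls back
    through countable operations on boxes, and the null set pulls back to a null, hence measurable,
    set. *)
Lemma measurable_of_box_null : measurable_fun setT p.
Proof.
move=> _ A mA; rewrite setTI.
rewrite -[A]setIT -(@cube_cover R n) setI_bigcupr preimage_bigcup.
apply: bigcupT_measurable => k; move: (A `&` _) (measurableI _ _ mA (box_measurable (cube k))) (measureIr mu mA (box_measurable (@cube R n k))) => {mA}A mA Ak.
have Aoo : mu A < +oo.
  by rewrite (le_lt_trans Ak)// (le_lt_trans (lebesgue_box_le _))// ltry.
have [B [AB B0]] := box_hull mA Aoo.
set G := \bigcap_j _ in AB B0.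
rewrite (_ : A = G `\` (G `\` A)); last by rewrite setDD setIidr.
rewrite (_ : p @^-1` _ = p @^-1` G `\` p @^-1` (G `\` A))//; apply: measurableD; last exact/null_measurable/null_preimage.
rewrite preimage_bigcap; apply: bigcapT_measurable => j.
by rewrite preimage_bigcup; apply: bigcupT_measurable => l.
Qed.

Lemma ae_preimage (P : 'rV[R]_n -> Prop) : {ae mu, forall x, P x} ->
  {ae mu, forall z, P (p z)}.
Proof.
move=> [A [mA A0 PA]]; exists (p @^-1` A); split; first exact/null_measurable/null_preimage.
  exact: null_preimage.
by move=> z /= /PA.
Qed.

End lift.

(** * The two projections of R^(n+m) *)

Section submx.
Context {R : realType} {n m : nat}.
Local Notation mu := (@lebesgue_rV R).

Lemma volume_row_mx (a b : 'rV[R]_n) (a' b' : 'rV[R]_m) :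
  volume (Some (row_mx a a', row_mx b b')) =
  (volume (Some (a, b)) * volume (Some (a', b')))%R.
Proof.
rewrite /= big_split_ord /=.
by congr (_ * _)%R; apply: eq_bigr => i _; rewrite ?(row_mxEl, row_mxEr).
Qed.

(** Over a cube of the second factor, the preimage of a box lies in a product box, whose volume is
    multiplied by the constant [volume (cube k.+1)]. *)
Lemma null_lsubmx (A : set 'rV[R]_n) : mu A = 0 ->
  mu ((@lsubmx R 1 n m) @^-1` A) = 0.
Proof.
move=> A0; apply: (@null_of_cubes _ _ _ (@rsubmx R 1 n m)) => k.
apply: (null_preimage_restr (volume_cube_gt0 k)) A0 => -[[a b]|]; last first.
  by exists None; split => [x []|]//=; rewrite mulr0.
exists (Some (row_mx a (const_mx (- k.+1%:R)), row_mx b (const_mx k.+1%:R)))%R.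
split; last by rewrite volume_row_mx mulrC; exact: lexx.
move=> z [/= zab zk] i; rewrite -[z]hsubmxK.
by case: (split_ordP i) => j ->; rewrite ?(row_mxEl, row_mxEr).
Qed.

Lemma null_rsubmx (A : set 'rV[R]_m) : mu A = 0 ->
  mu ((@rsubmx R 1 n m) @^-1` A) = 0.
Proof.
move=> A0; apply: (@null_of_cubes _ _ _ (@lsubmx R 1 n m)) => k.
apply: (null_preimage_restr (volume_cube_gt0 k)) A0 => -[[a b]|]; last first.
  by exists None; split => [x []|]//=; rewrite mulr0.
exists (Some (row_mx (const_mx (- k.+1%:R)) a, row_mx (const_mx k.+1%:R) b))%R.
split; last by rewrite volume_row_mx; exact: lexx.
move=> z [/= zab zk] i; rewrite -[z]hsubmxK.
by case: (split_ordP i) => j ->; rewrite ?(row_mxEl, row_mxEr).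
Qed.

Lemma measurable_lsubmx : measurable_fun setT (@lsubmx R 1 n m).
Proof.
apply: measurable_of_box_null; last exact: null_lsubmx.
move=> B; apply: preimage_box_measurable => i; under eq_fun do rewrite mxE.
exact: measurable_coord.
Qed.

Lemma measurable_rsubmx : measurable_fun setT (@rsubmx R 1 n m).
Proof.
apply: measurable_of_box_null; last exact: null_rsubmx.
move=> B; apply: preimage_box_measurable => i; under eq_fun do rewrite mxE.
exact: measurable_coord.
Qed.

End submx.

(** * Integrals of nonnegative, possibly non-measurable functions *)

Section nonneg_integral.
Context d (T : measurableType d) (R : realType) (mu : {measure set T -> \bar R}).

(* No measurability is assumed, in contrast with [ge0_le_integral]: it will be
   applied to x |-> W x (u x), with W only Lebesgue measurable. *)
Lemma ge0_le_integralS (D : set T) (f g : T -> \bar R) :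
  (forall x, D x -> 0 <= f x) -> (forall x, D x -> f x <= g x) ->
  \int[mu]_(x in D) f x <= \int[mu]_(x in D) g x.
Proof.
move=> f0 fg; rewrite !ge0_integralE//; last first.
  by move=> x Dx; exact: le_trans (f0 x Dx) (fg x Dx).
apply: ereal_sup_le => _ [h /= hf <-]; exists h => // x.
apply: le_trans (hf x) _; rewrite /patch; case: ifPn => // /set_mem; exact: fg.
Qed.

(** On [D], [f] is at most the function equal to +oo on a null set and 0 elsewhere, whose integral
    is +oo * 0 = 0. *)
Lemma ge0_ae0_integral (D : set T) (f : T -> \bar R) : measurable D ->
  (forall x, D x -> 0 <= f x) -> {ae mu, forall x, D x -> f x = 0} ->
  \int[mu]_(x in D) f x = 0.
Proof.
move=> mD f0 [N [mN N0 fN]]; apply/eqP; rewrite eq_le integral_ge0// andbT.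
apply: (@le_trans _ _ (\int[mu]_(x in D) ((cst +oo) \_ N) x)).
  apply: ge0_le_integralS => // x Dx; rewrite /patch.
  case: ifPn => [|/negP xN]; first by rewrite leey.
  rewrite [leLHS](_ : _ = 0)//; apply: contrapT => fx; apply: xN.
  by apply/mem_set/fN => /= /(_ Dx).
rewrite -integral_mkcondr integral_cst; last exact: measurableI.
rewrite [X in _ * X](_ : _ = 0) ?mule0//; apply/eqP.
by rewrite eq_le measure_ge0 andbT -N0 le_measure ?inE//; exact: measurableI.
Qed.

End nonneg_integral.

(** * Lower limits in the extended reals *)

Section ereal_limits.
Context {R : realType}.
Implicit Types (x y c : \bar R) (a : nat -> \bar R).

(** Lets a bound by a possibly infinite liminf be tested on the real numbers above it. *)
Lemma lee_of_lt_fin x y : (forall r : R, x < r%:E -> y <= r%:E) -> y <= x.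
Proof.
case: x => [r|_|xy]; last 2 first.
- exact: leey.
- case: y xy => [r||//] xy; last by have := xy 0%R (ltNyr _).
  pose r1 : R := (r - 1)%R; have := xy r1 (ltNyr _).
  by rewrite lee_fin leNgt /r1 ltrBlDr ltrDl ltr01.
by move=> xy; apply/lee_addgt0Pr => e e0; apply: xy; rewrite lte_fin ltrDl.
Qed.

Lemma limn_einf_le a c : (forall k, a k <= c) -> limn_einf a <= c.
Proof.
move=> ac; rewrite /limn_einf /limn_esup limf_esupN oppeK limf_einfE; apply: ge_ereal_sup => _ [V Voo <-].
have [k Vk] := filter_ex Voo.
by apply: le_trans (ac k); apply: ereal_inf_lbound; exists k.
Qed.

Lemma limn_einf_ge a c : (forall k, c <= a k) -> c <= limn_einf a.
Proof.
move=> ca; rewrite /limn_einf /limn_esup limf_esupN oppeK limf_einfE.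
apply: (@le_trans _ _ (ereal_inf (a @` setT))).
  by apply: le_ereal_inf_tmp => _ [k _ <-].
by apply: ereal_sup_ubound; exists setT => //; exact: filterT.
Qed.

(** Here [c] stands for a value of the kernel, possibly +oo, and the product is not continuous at 0
    * +oo. When [c] is +oo: if [l] is 0 the left side is 0; if [l] is positive, so is [t k]
    eventually, and the products are +oo. *)
Lemma mule_limn_einf_ge (t : nat -> R) (l : R) c :
  t k @[k --> \oo] --> l -> (forall k, 0 <= t k)%R ->
  (0 <= l)%R -> 0 <= c ->
  l%:E * c <= limn_einf (fun k => (t k)%:E * c).
Proof.
move=> tl t0 l_ge0; have t_ge0 b k : 0 <= b -> 0 <= (t k)%:E * b.
  by move=> b0; rewrite mule_ge0// lee_fin.
case: c => [r||//] c0.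
  suff /cvg_limn_einf_sup[-> _] : (t k)%:E * r%:E @[k --> \oo] --> l%:E * r%:E by [].
  under eq_fun do rewrite -EFinM; rewrite -EFinM.
  by apply: cvg_EFin; [exact: nearW|exact: cvgMr_tmp].
have [->|l0] := eqVneq l 0%R.
  by rewrite mul0e; apply: limn_einf_ge => k; exact: t_ge0.
suff /cvg_limn_einf_sup[-> _] : (t k)%:E * +oo @[k --> \oo] --> +oo by rewrite leey.
apply: cvg_near_cst.
have lgt0 : (0 < l)%R by rewrite lt_neqAle eq_sym l0.
near=> k; rewrite gt0_muley// lte_fin; near: k.
exact: cvgr_gt tl _ lgt0.
Unshelve. all: by end_near. Qed.

End ereal_limits.

(** * Almost everywhere convergence from fast L^1 convergence *)

Section ae_convergence.
Context {R : realType} {n : nat}.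
Local Notation mu := (@lebesgue_rV R n).

Lemma calX_ae_le1 (u : 'rV[R]_n -> R) : calX u ->
  {ae mu, forall x, (`|u x| <= 1)%R}.
Proof.
move=> [mfu]; rewrite unlock /=; case: ifPn => [_ /ess_sup_inf.ess_supP|mu0 _].
  by apply: filterS => x /=; rewrite lee_fin.
(* In this branch the whole space is null, so it can serve as the exceptional set. *)
exists setT; split => //; apply: lebesgue_le0.
by rewrite leNgt.
Qed.

(** Compact counterpart of [cube], since [L1loc_cvg] tests compact sets. *)
Definition closed_cube (k : nat) : set 'rV[R]_n :=
  [set x | forall i, [set` `[(- k%:R)%R, k%:R%R]] (x ord0 i)].

Lemma closed_cube_compact k : compact (closed_cube k).
Proof.
apply: (@rV_compact R n (fun=> (`[(- k%:R)%R, k%:R%R]%classic : set R))) => i; exact: segment_compact.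
Qed.

Lemma closed_cube_measurable k : measurable (closed_cube k).
Proof.
apply: (@preimage_coordinatewise_measurable _ _ _ _ id
  (fun=> `[(- k%:R)%R, k%:R%R]%classic)) => // i; exact: measurable_coord.
Qed.

Lemma subset_closed_cube k l : (k <= l)%N -> closed_cube k `<=` closed_cube l.
Proof.
move=> kl x xk i; have := xk i; rewrite /= !in_itv/= => /andP[kx xk'].
by rewrite (le_trans _ kx) ?(le_trans xk')// ?lerN2 ler_nat.
Qed.

Lemma closed_cube_cover x : exists k, closed_cube k x.
Proof.
have : (\bigcup_k box (@cube R n k)) x by rewrite cube_cover.
case=> k _ xk; exists k => i; have := xk i.
by rewrite !mxE /= in_itv/= => /andP[/ltW -> ->].
Qed.

(** On a fixed cube the series of the |v_k - u|, from some index on, has finite integral; it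
    converges almost everywhere, so its terms tend to 0. *)
Lemma ae_cvg_of_L1_small (v : nat -> 'rV[R]_n -> R) (u : 'rV[R]_n -> R) :
  (forall k, measurable_fun setT (v k)) -> measurable_fun setT u ->
  (forall k, \int[mu]_(x in closed_cube k) (`|v k x - u x|%R)%:E <=
    (1 / (2 ^ k.+1)%:R)%:E) ->
  {ae mu, forall x, v k x @[k --> \oo] --> u x}.
Proof.
move=> mv mfu vu.
suff vu_cube m : {ae mu, forall x, closed_cube m x -> v k x @[k --> \oo] --> u x}.
  have /ae_foralln := vu_cube; apply: filterS => x xP.
  by have [m /xP] := closed_cube_cover x.
have mC := closed_cube_measurable m.
(* The bound on the cube of index k controls that of index [m] only for k >= m, hence the shift. *)
pose f k x := (`|v (k + m)%N x - u x|%R)%:E.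
have mf k : measurable_fun (closed_cube m) (f k).
  apply/measurable_EFinP; apply: measurableT_comp => //.
  by apply: measurable_funTS; exact: measurable_funB.
have f0 k x : closed_cube m x -> 0 <= f k x by move=> _; rewrite lee_fin.
have sum_lty : \int[mu]_(x in closed_cube m) (\sum_(k <oo) f k x) < +oo.
  rewrite integral_nneseries//.
  apply: (@le_lt_trans _ _ (\sum_(k <oo) (1 / (2 ^ k.+1)%:R)%:E)); last first.
    by rewrite (le_lt_trans (epsilon_trick0 _ _))// ltry.
  apply: lee_nneseries => k *; first by apply: integral_ge0 => x; exact: f0.
  apply: (@le_trans _ _ (1 / (2 ^ (k + m).+1)%:R)%:E); last first.
    rewrite lee_fin ler_pdivrMr// mulrAC ler_pdivlMr// !mul1r ler_nat.
    by rewrite leq_exp2l// ltnS leq_addr.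
  apply: le_trans (vu (k + m)%N); apply: ge0_subset_integral => //.
  - exact: closed_cube_measurable.
  - apply/measurable_EFinP; apply: measurableT_comp => //.
    by apply: measurable_funTS; exact: measurable_funB.
  - by move=> x _; rewrite lee_fin.
  - by apply: subset_closed_cube; rewrite leq_addl.
have : mu.-integrable (closed_cube m) (fun x => \sum_(k <oo) f k x).
  apply/integrableP; split.
    by apply: ge0_emeasurable_sum => // k x Cx _; exact: f0.
  under eq_integral => x xC.
    rewrite gee0_abs; last by apply: nneseries_ge0 => k _ _; rewrite lee_fin.
    over.
  exact: sum_lty.
move/(integrable_ae mC); apply: filterS => x + Cx => /(_ Cx) xfin.
have : cvgn (series (fun k => `|v (k + m)%N x - u x|%R)).
  by apply: nnseries_is_cvg => //; rewrite -ge0_fin_numE// nneseries_ge0.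
move=> /cvg_series_cvg_0 /norm_cvg0P vu0.
by rewrite -(cvg_shiftn m); apply/subr_cvg0.
Qed.

End ae_convergence.

(** * Lower semicontinuity of the kinetic term, and limits valued in the wells *)

Section gamma_limit.
Context {R : realType} {n : nat}.
Local Notation mu := (@lebesgue_rV R n).
Implicit Types (u : 'rV[R]_n -> R) (v : nat -> 'rV[R]_n -> R).
Implicit Types (Omega : set 'rV[R]_n).

Lemma crossing_measurable Omega : measurable Omega ->
  measurable (crossing Omega).
Proof.
move=> mO; apply: measurableC.
rewrite (_ : [set _ | _] = @lsubmx R 1 n n @^-1` (~` Omega) `&`
                           @rsubmx R 1 n n @^-1` (~` Omega))//.
apply: measurableI; rewrite -[X in measurable X]setTI.
- by apply: measurable_lsubmx => //; exact: measurableC.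
- by apply: measurable_rsubmx => //; exact: measurableC.
Qed.

(** Fatou's lemma. As [K] may be infinite, the integrand of [u] is only bounded by the liminf of the
    integrands, almost everywhere. *)
Lemma calK_le_of_ae_cvg (K : 'rV[R]_n -> 'rV[R]_n -> \bar R) v u Omega
    (c : R) :
  (forall x y, 0 <= K x y) ->
  measurable_fun setT (fun z : 'rV[R]_(n + n) => K (lsubmx z) (rsubmx z)) ->
  (forall k, measurable_fun setT (v k)) -> measurable_fun setT u ->
  {ae mu, forall x, v k x @[k --> \oo] --> u x} ->
  measurable Omega ->
  (forall k, calK K (v k) Omega <= c%:E) -> calK K u Omega <= c%:E.
Proof.
move=> K0 mK mv mfu vu mO Kv.
have mC := crossing_measurable mO.
pose F (w : 'rV[R]_n -> R) (z : 'rV[R]_(n + n)) :=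
  (`|w (lsubmx z) - w (rsubmx z)| ^+ 2)%:E * K (lsubmx z) (rsubmx z).
have F0 w z : 0 <= F w z by rewrite mule_ge0// lee_fin exprn_ge0.
have mF w : measurable_fun setT w -> measurable_fun (crossing Omega) (F w).
  move=> mw; apply: measurable_funTS; apply: emeasurable_funM => //.
  apply/measurable_EFinP/measurable_funX; apply: measurableT_comp => //.
  apply: measurable_funB.
  - exact: measurableT_comp mw measurable_lsubmx.
  - exact: measurableT_comp mw measurable_rsubmx.
rewrite /calK lee_pdivrMl//.
apply: (@le_trans _ _ (\int[@lebesgue_rV R (n + n)]_(z in crossing Omega)
    limn_einf (fun k => F (v k) z))).
  apply: ae_ge0_le_integral => //.
  - by move=> z _; exact: F0.
  - exact: mF.
  - by move=> z _; apply: limn_einf_ge => k; exact: F0.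
  - rewrite /limn_einf; apply: measurableT_comp => //.
    apply: (@measurable_fun_limn_esup _ _ _ _ (fun k z => - F (v k) z)) => k.
    by apply: measurableT_comp => //; exact: mF.
  (* The null set of non-convergence has null preimages under both projections, so convergence holds
     at both components of almost every z. *)
  have vul := ae_preimage (@null_lsubmx R n n) vu.
  have vur := ae_preimage (@null_rsubmx R n n) vu.
  apply: filterS2 vul vur => z vl vr _.
  apply: mule_limn_einf_ge => //.
  rewrite expr2; under eq_fun do rewrite expr2.
  by apply: cvgM; apply: cvg_norm; exact: cvgB.
have Fatou := fatou (@lebesgue_rV R (n + n)) mC (fun k => mF _ (mv k))
  (fun k z _ => F0 (v k) z).
apply: le_trans Fatou _.
by apply: limn_einf_le => k; rewrite -lee_pdivrMl//; exact: Kv.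
Qed.

Lemma norm_sublevel_measurable u (theta : R) : measurable_fun setT u ->
  measurable [set x | (`|u x| <= theta)%R].
Proof.
move=> mfu.
rewrite (_ : [set _ | _] = setT `&` (fun x => `|u x|%R) @^-1` `]-oo, theta]%classic).
  by apply: measurableT_comp => //; exact: measurable_itv.
by apply/seteqP; split => x; rewrite /= in_itv//= => -[].
Qed.

(** Borel-Cantelli: almost every point lies in only finitely many of the sets [F k], whereas a point
    of [Omega] where |u| < theta and v_k -> u lies in all but finitely many. *)
Lemma ae_norm_ge v u Omega (theta : R) :
  measurable Omega -> (forall k, measurable_fun setT (v k)) ->
  {ae mu, forall x, v k x @[k --> \oo] --> u x} ->
  \sum_(k <oo) mu (Omega `&` [set x | (`|v k x| <= theta)%R]) < +oo ->
  {ae mu, forall x, Omega x -> (theta <= `|u x|)%R}.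
Proof.
move=> mO mv vu sum_lty.
pose F k := Omega `&` [set x | (`|v k x| <= theta)%R].
have mF k : measurable (F k).
  by apply: measurableI => //; exact: norm_sublevel_measurable.
have limF0 := lim_sup_set_cvg0 mF sum_lty.
have limF : {ae mu, forall x, ~ lim_sup_set F x}.
  exists (lim_sup_set F); split => //.
    by apply: bigcapT_measurable => k; apply: bigcup_measurable => l _; exact: mF.
  by move=> x /= /contrapT.
apply: filterS2 vu limF => x vux Fx Ox; rewrite leNgt; apply/negP => uth.
apply: Fx => k _.
have [l _ lv] : \forall l \near \oo, (`|v l x| < theta)%R.
  by apply: cvgr_lt uth; exact: cvg_norm.
exists (maxn k l); first by rewrite /= leq_maxl.
by split => //=; rewrite ltW// lv//= leq_maxr.
Qed.

(** Chebyshev's inequality, turning a small potential energy into a small measure of the set away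
    from the wells. *)
Lemma level_set_integral_le (w : 'rV[R]_n -> R) (W : 'rV[R]_n -> R -> R)
    Omega (g theta : R) :
  measurable Omega -> measurable_fun setT w ->
  (forall x r, 0 <= W x r)%R -> (0 <= g)%R ->
  (forall x r, `|r| <= theta -> g <= W x r)%R ->
  g%:E * mu (Omega `&` [set x | (`|w x| <= theta)%R]) <=
  \int[mu]_(x in Omega) (W x (w x))%:E.
Proof.
move=> mO mw W0 g0 Wg.
set A := [set x | _].
have mA : measurable A by exact: norm_sublevel_measurable.
rewrite -integral_cst; last exact: measurableI.
rewrite integral_mkcondr; apply: ge0_le_integralS => x _; rewrite /patch.
  by case: ifPn => //; rewrite lee_fin.
case: ifPn => [/set_mem xA|_]; rewrite lee_fin; [exact: Wg|exact: W0].
Qed.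

Lemma calG_eq_calK (K : 'rV[R]_n -> 'rV[R]_n -> \bar R) u Omega :
  measurable Omega -> measurable_fun setT u ->
  {ae mu, forall x, Omega x -> (`|u x| = 1)%R} ->
  calG K u Omega = calK K u Omega.
Proof.
move=> mO mfu u1; rewrite /calG asboolT//.
(* Where |u| = 1, being positive means being 1. *)
exists (Omega `&` u @^-1` `]0%R, +oo[%classic); split.
- by apply: measurableI => //; rewrite -[X in measurable X]setTI; apply: mfu.
- exact: subIsetl.
apply: filterS u1 => x ux Ox; have {}ux := ux Ox.
rewrite !indicE in_setC; have [u_ge0|u_lt0] := lerP 0%R (u x).
  rewrite mem_set/= ?subr0; first by rewrite -ux ger0_norm.
  split => //=; rewrite in_itv/= andbT lt_neqAle u_ge0 andbT eq_sym.
  by rewrite -normr_eq0 ux oner_neq0.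
rewrite memNset/= ?sub0r; first by rewrite -ux ltr0_norm// opprK.
by move=> [_]; rewrite /= in_itv/= andbT ltNge ltW.
Qed.

(** Serves to pick one parameter of energy below [c] that also meets several eventual conditions. *)
Lemma limf_einf_lt_exists (f : R -> \bar R) (F : set_system R) (c : \bar R)
    (V : set R) :
  limf_einf f F < c -> F V -> exists2 t, V t & f t < c.
Proof.
rewrite limf_einfE => fc FV.
have /ereal_inf_lt[_ [t Vt <-] ftc] : ereal_inf (f @` V) < c.
  by apply: le_lt_trans fc; apply: ereal_sup_ubound; exists V.
by exists t.
Qed.

End gamma_limit.

(** Borel-Cantelli gives |u| >= theta for a sequence of theta tending to 1, so that only countably
    many null sets are discarded; |u| <= 1 comes from [calX]. *)
Lemma unit_modulus_of_energy_bound (R : realType) (n : nat)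
    (W : 'rV[R]_n -> R -> R) (gamma : R -> R) (v : nat -> 'rV[R]_n -> R)
    (u : 'rV[R]_n -> R) (Omega : set 'rV[R]_n) :
  (forall x r, (0 <= W x r)%R) ->
  (forall theta, (0 <= theta < 1)%R -> (0 < gamma theta)%R) ->
  (forall theta, (0 <= theta < 1)%R ->
    forall x r, (`|r| <= theta -> gamma theta <= W x r)%R) ->
  measurable Omega -> (forall k, calX (v k)) -> calX u ->
  {ae @lebesgue_rV R n, forall x, v k x @[k --> \oo] --> u x} ->
  (forall k, \int[@lebesgue_rV R n]_(x in Omega) (W x (v k x))%:E <=
    (1 / (2 ^ k.+1)%:R)%:E) ->
  {ae @lebesgue_rV R n, forall x, Omega x -> (`|u x| = 1)%R}.
Proof.
move=> W0 gamma_gt0 Wgamma mO Xv Xu vu Wv.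
pose theta (j : nat) : R := (1 - j.+1%:R^-1)%R.
have theta01 j : (0 <= theta j < 1)%R.
  by rewrite subr_ge0 invf_le1// ler1n/= ltrBlDr ltrDl invr_gt0 ltr0n.
have u_ge : {ae @lebesgue_rV R n, forall x, forall j : nat,
    Omega x -> (theta j <= `|u x|)%R}.
  apply: ae_foralln => j; apply: (ae_norm_ge (v := v)) => //.
    by move=> k; exact: (Xv k).1.
  have g0 := gamma_gt0 _ (theta01 j).
  (* Chebyshev's inequality divided by [gamma (theta j)] bounds the k-th measure by a multiple of
     2^-(k+1), summable in k. *)
  apply: (@le_lt_trans _ _
    (\sum_(k <oo) ((gamma (theta j))^-1 / (2 ^ k.+1)%:R)%:E)).
    apply: lee_nneseries => k *; first exact: lebesgue_outer_ge0.
    rewrite EFinM lee_pdivlMl//; apply: le_trans (_ : _ <= (1 / (2 ^ k.+1)%:R)%:E) _.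
      apply: le_trans (Wv k); apply: level_set_integral_le => //.
      - exact: (Xv k).1.
      - exact: ltW.
      - exact: Wgamma.
    by rewrite div1r.
  by rewrite (le_lt_trans (epsilon_trick0 _ _)) ?ltry// invr_ge0 ltW.
apply: filterS2 u_ge (calX_ae_le1 Xu) => x ux u_le1 Ox.
apply/eqP; rewrite eq_le u_le1/=; apply/ler_addgt0Pr => e e0.
(* This index j makes 1/(j+1) smaller than e, so 1 - e <= theta j. *)
rewrite -lerBlDr; apply: le_trans (ux (Num.trunc e^-1) Ox).
by rewrite lerB// ltW// invf_plt ?posrE// truncnS_gt.
Qed.

(** * The two inequalities of Gamma-convergence *)

Theorem proposition1p8 (R : realType) (n : nat) (s : R)
  (K : 'rV[R]_n -> 'rV[R]_n -> \bar R) (W : 'rV[R]_n -> R -> R)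
  (gamma : R -> R) (kappa : R)
  (n_ge1 : (1 <= n)%N)
  (s_gt0 : (0 < s)%R) (s_lt : (s < 1 / 2)%R)
  (K_ge0 : forall x y, 0 <= K x y)
  (K_meas : measurable_fun [set: 'rV[R]_(n + n)]
    (fun z => K (lsubmx z) (rsubmx z)))
  (K_sym : {ae @lebesgue_rV R (n + n), forall z,
    K (lsubmx z) (rsubmx z) = K (rsubmx z) (lsubmx z)})
  (W_ge0 : forall x r, (0 <= W x r)%R)
  (W_meas : measurable_fun [set: 'rV[R]_(n + 1)]
    (fun z => W (lsubmx z) (rsubmx z ord0 ord0)))
  (W_derivable : forall x r, derivable (W x) r 1)
  (W_C1 : forall x, continuous (derive1 (W x)))
  (W_wells : {ae @lebesgue_rV R n, forall x, W x 1%R = 0%R /\ W x (- 1)%R = 0%R})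
  (gamma_gt0 : forall theta, (0 <= theta < 1)%R -> (0 < gamma theta)%R)
  (gamma_noninc : forall t1 t2, (0 <= t1)%R -> (t1 <= t2)%R -> (t2 < 1)%R ->
    (gamma t2 <= gamma t1)%R)
  (W_inf : forall theta, (0 <= theta < 1)%R ->
    (gamma theta)%:E <=
    ereal_inf [set (W p.1 p.2)%:E |
      p in [set p : 'rV[R]_n * R | (`|p.2| <= theta)%R]])
  (kappa_gt0 : (0 < kappa)%R) (kappa_lt1 : (kappa < 1)%R)
  (W_bound : {ae @lebesgue_rV R n, forall x, forall r,
    (W x r <= kappa^-1)%R /\ (`|derive1 (W x) r| <= kappa^-1)%R}) :
  (forall (u_ : R -> 'rV[R]_n -> R) (u : 'rV[R]_n -> R),
    (forall eps, (0 < eps)%R -> calX (u_ eps)) -> calX u ->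
    L1loc_cvg 0^'+ u_ u ->
    forall Omega : set 'rV[R]_n, open Omega ->
      calG K u Omega <=
      limf_einf (fun eps => calE s K W eps (u_ eps) Omega) 0^'+) /\
  (forall u : 'rV[R]_n -> R, calX u ->
    exists u_ : R -> 'rV[R]_n -> R,
      [/\ forall eps, (0 < eps)%R -> calX (u_ eps),
          L1loc_cvg 0^'+ u_ u &
          forall Omega : set 'rV[R]_n, open Omega ->
            limf_esup (fun eps => calE s K W eps (u_ eps) Omega) 0^'+ <=
            calG K u Omega]).
Proof.
have Wgamma theta : (0 <= theta < 1)%R ->
    forall x r, (`|r| <= theta -> gamma theta <= W x r)%R.
  move=> th x r rth; rewrite -lee_fin; apply: le_trans (W_inf _ th) _.
  by apply: ereal_inf_lbound; exists (x, r).
have intW_ge0 u (Omega : set 'rV[R]_n) :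
    0 <= \int[@lebesgue_rV R n]_(x in Omega) (W x (u x))%:E.
  by apply: integral_ge0 => x _; rewrite lee_fin.
split=> [u_ u Xu_ Xu u_u Omega oO|u Xu].
  have mO := open_measurable_rV oO.
  apply: lee_of_lt_fin => c lt_c.
  (* The third condition turns the energy bound into a summable bound on the potential integrals; in
     the fourth, the cube grows with k, so that one sequence serves all cubes. *)
  have /choice[e eP] : forall k : nat, exists e : R, [/\ (0 < e)%R,
      calE s K W e (u_ e) Omega < c%:E,
      (c * e `^ (2 * s) <= 1 / (2 ^ k.+1)%:R)%R &
      \int[@lebesgue_rV R n]_(x in closed_cube k) (`|u_ e x - u x|%R)%:E <=
        (1 / (2 ^ k.+1)%:R)%:E].
    move=> k; have d0 : (0 < 1 / (2 ^ k.+1)%:R :> R)%R.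
      by rewrite divr_gt0// ltr0n expn_gt0.
    have e_gt0 : \forall e \near 0^'+, (0 < e :> R)%R by exact: nbhs_right_gt.
    have e_pow : \forall e \near 0^'+,
        (c * e `^ (2 * s) < 1 / (2 ^ k.+1)%:R)%R.
      (* Positivity of s enters here: e^(2s) tends to 0 with e. *)
      have cpow : (c * e `^ (2 * s))%R @[e --> 0^'+] --> (c * 0)%R.
        by apply: cvgMl_tmp; apply: powR_cvg0; rewrite mulr_gt0.
      by apply: (cvgr_lt _ cpow); rewrite mulr0.
    have e_L1 : \forall e \near 0^'+,
        \int[@lebesgue_rV R n]_(x in closed_cube k) (`|u_ e x - u x|%R)%:E <
        (1 / (2 ^ k.+1)%:R)%:E.
      have := u_u _ (@closed_cube_compact R n k)
        [set y : \bar R | y < (1 / (2 ^ k.+1)%:R)%:E].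
      by apply; apply: open_ereal_lt'; rewrite lte_fin.
    have [e [[? ?] ?] ?] := limf_einf_lt_exists lt_c
      (filterI (filterI e_gt0 e_pow) e_L1).
    by exists e; split => //; exact: ltW.
  pose v k := u_ (e k).
  have Xv k : calX (v k) by have [e0 _ _ _] := eP k; exact: Xu_.
  have vu : {ae @lebesgue_rV R n, forall x, v k x @[k --> \oo] --> u x}.
    apply: ae_cvg_of_L1_small => [k||k]; [exact: (Xv k).1|exact: Xu.1|].
    by have [] := eP k.
  have calK_ge0 k : 0 <= calK K (v k) Omega.
    rewrite mule_ge0 ?lee_fin ?invr_ge0//; apply: integral_ge0 => z _.
    by rewrite mule_ge0// lee_fin exprn_ge0.
  rewrite calG_eq_calK//; last first.
  - apply: (unit_modulus_of_energy_bound W_ge0 gamma_gt0 Wgamma mO Xv Xu vu) => k.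
    have [e0 Ek ck _] := eP k.
    have ek0 : (0 < e k `^ (2 * s))%R by rewrite powR_gt0.
    (* The kinetic term being nonnegative, e^(-2s) times the potential integral is at most c. *)
    apply: (@le_trans _ _ (c * e k `^ (2 * s))%:E); last by rewrite lee_fin.
    rewrite mulrC EFinM -lee_pdivrMl// -div1r.
    apply: le_trans (ltW Ek); rewrite /calE leeDr//; exact: calK_ge0.
  - exact: Xu.1.
  apply: (calK_le_of_ae_cvg K_ge0 K_meas _ Xu.1 vu mO) => k.
    exact: (Xv k).1.
  have [e0 Ek _ _] := eP k; apply: le_trans (ltW Ek).
  by rewrite /calE leeDl// mule_ge0// lee_fin divr_ge0// powR_ge0.
exists (fun=> u); split => //.
  move=> C _; rewrite (_ : (fun=> _) = fun=> 0); first exact: cvg_cst.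
  by apply/funext => t; apply: integral0_eq => x _; rewrite subrr normr0.
move=> Omega oO; have mO := open_measurable_rV oO.
rewrite /calG; case: asboolP => [[E [mE EO uE]]|_]; last by rewrite leey.
have W0 : \int[@lebesgue_rV R n]_(x in Omega) (W x (u x))%:E = 0.
  apply: ge0_ae0_integral => //; first by move=> x _; rewrite lee_fin.
  apply: filterS2 uE W_wells => x uE [W1 WN1] Ox.
  rewrite uE// !indicE in_setC; case: (x \in E) => /=.
    by rewrite subr0 W1.
  by rewrite sub0r WN1.
rewrite /calE W0; under [X in limf_esup X _]eq_fun do rewrite mule0 adde0.
rewrite limf_esupE.
(* The energy no longer depends on eps, so the supremum over the whole line already bounds its
   limsup. *)
apply: (@le_trans _ _ (ereal_sup ((fun=> calK K u Omega) @` [set: R]))).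
  by apply: ereal_inf_lbound; exists setT => //; exact: filterT.
by apply: ge_ereal_sup => _ [t _ <-].
Qed.
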